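(* For every finite group $N$, the following conditions are equivalent. (i) Gaschütz's theorem holds for $N$. (ii) For every finite group $B$ with $N \unlhd B$, if $N/N'$ has a complement in $B/N'$, then $N$ has a complement in $B$. Moreover, if (ii) fails for $B$ (that is, $B$ is a finite group with $N \unlhd B$ such that $N/N'$ has a complement in $B/N'$ but $N$ has no complement in $B$), then for every prime $p \nmid |B|$ there are finite groups $G$ and $H$ with $N \unlhd G$ and $N \le H \unlhd G$ such that $G/H \cong C_p$ and $N$ has a complement in $H$ but not in $G$.
   Context: All groups are finite. $N'$ denotes the commutator (derived) subgroup of $N$, and $C_p$ is the cyclic group of order $p$. A complement of a normal subgroup $N \unlhd G$ is a subgroup $C \le G$ with $G = NC$ and $N \cap C = 1$. ''Gaschütz's theorem holds for $N$'' means: for all finite groups $G$ and $H$ with $N \unlhd G$, $N \le H \le G$ and $\gcd(|N|, [G:H]) = 1$, if $N$ has a complement in $H$, then $N$ has a complement in $G$. As usual, $N$ being a (normal) subgroup of a constructed group is understood up to identifying $N$ with an isomorphic copy. *)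

(* Defs.v *)
From mathcomp Require Import all_boot all_order all_algebra all_fingroup all_solvable.

Set Implicit Arguments.
Unset Strict Implicit.
Unset Printing Implicit Defensive.

Local Open Scope group_scope.

(* "N is a normal subgroup of G" is understood up to isomorphism: the ambient
   finGroupType rT is arbitrary, and M \subset G is an isomorphic copy of N
   living in rT. *)

Definition gaschutz_holds (gT : finGroupType) (N : {group gT}) : Prop :=
  forall (rT : finGroupType) (M G H : {group rT}),
    M \isog N -> M <| G -> M \subset H -> H \subset G ->
    coprime #|M| #|G : H| ->
    [splits H, over M] -> [splits G, over M].

Definition splits_if_abelianization_splits
    (gT : finGroupType) (N : {group gT}) : Prop :=
  forall (rT : finGroupType) (M B : {group rT}),
    M \isog N -> M <| B ->
    [splits B / M^`(1), over M / M^`(1)] -> [splits B, over M].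

(* Main.v *)
Require Import Defs.
From mathcomp Require Import all_boot all_order all_algebra all_fingroup all_solvable.

(* (ii) => (i) is Gaschutz's theorem for the abelian normal subgroup M/M'. For
   the rest, let C/M' complement M/M' in B/M', with M uncomplemented in B, and
   let p be a prime not dividing #|B|. In the regular wreath product of B by a cyclic
   group P of order p, put W = [M^p, P]; then W = [W, P], and W contains the
   diagonal copy of M'. Take G to be the group generated by W x M, P x 1 and the
   pairs (diag c, c) for c in C, take H to be generated by the first and last of
   these, and K = 1 x M. Projection to one coordinate of B^p gives a complement
   of K in H. A complement X of K in G may be assumed to contain P x 1 (Sylow),
   hence contains [W, P] x 1 = W x 1, and then the projection of X to B is a
   complement of M, a contradiction. *)

Set Implicit Arguments.
Unset Strict Implicit.
Unset Printing Implicit Defensive.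

Local Open Scope group_scope.

(** * Normalizers of direct products and coprime action *)

Lemma setX_norms (gT1 gT2 : finGroupType) (A1 K1 : {group gT1})
    (A2 K2 : {group gT2}) :
  A1 \subset 'N(K1) -> A2 \subset 'N(K2) -> setX A1 A2 \subset 'N(setX K1 K2).
Proof.
move=> /subsetP n1 /subsetP n2; apply/subsetP=> -[a b]; rewrite in_setX /=.
case/andP=> Aa Ab; rewrite inE; apply/subsetP=> _ /imsetP[[x y] + ->].
rewrite !in_setX /= => /andP[Kx Ky].
by rewrite !memJ_norm ?Kx ?Ky ?n1 ?n2.
Qed.

(* Modulo [V, A, A], [v, a ^+ n] is [v, a] ^+ n, so the order of [v, a] divides
   both #[a] and #|V|. Unlike the usual proof by coprime action, this requires
   no solvability. *)
Lemma coprime_commRR (gT : finGroupType) (V A : {group gT}) :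
  A \subset 'N(V) -> coprime #|V| #|A| -> [~: V, A, A] = [~: V, A].
Proof.
move=> nVA coVA; set W := [~: V, A]; set U := [~: W, A].
have sWV : W \subset V by rewrite commg_subl.
have nWA : A \subset 'N(W) by rewrite commg_normr.
have sUW : U \subset W by rewrite commg_subl.
have nUW : W \subset 'N(U) by rewrite commg_norml.
apply/eqP; rewrite eqEsubset sUW gen_subG.
apply/subsetP=> _ /imset2P[v a Vv Aa ->].
have Wc n : [~ v, a ^+ n] \in W by rewrite mem_commg ?groupX.
have nU x : x \in W -> x \in 'N(U) by apply: subsetP.
have Wa : [~ v, a] \in W by have:= Wc 1%N; rewrite expg1.
have pow n : coset U [~ v, a ^+ n] = coset U [~ v, a] ^+ n.
  elim: n => [|n IHn]; first by rewrite !expg0 commg1 morph1.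
  have Ua : [~ [~ v, a ^+ n], a] \in U by rewrite mem_commg.
  (* Here [[~ v, a ^+ n.+1]] is the product of [[~ v, a]], [[~ v, a ^+ n]] and [[~ [~ v, a ^+ n],
     a]]; the last factor lies in [U] and vanishes in the quotient. *)
  rewrite expgSr expgS commgMJ conjg_mulR -IHn.
  move: (Wc n) Ua => Wcn; move: [~ v, a ^+ n] Wcn => u Wu.
  move: [~ v, a] Wa [~ u, a] => w Ww t Ut.
  have Wt := subsetP sUW t Ut.
  by rewrite !morphM ?nU ?groupM //= (coset_id Ut) mulg1.
apply: coset_idr; rewrite ?nU //; apply/eqP.
rewrite -order_eq1 -dvdn1 -(eqP coVA) dvdn_gcd; apply/andP; split.
  have /order_dvdG Hd: coset U [~ v, a] \in W / U by rewrite mem_quotient.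
  exact: dvdn_trans Hd (dvdn_trans (dvdn_quotient _ _) (cardSg sWV)).
apply: dvdn_trans (order_dvdG Aa).
by rewrite order_dvdn -pow expg_order commg1 morph1.
Qed.

(** * Regular wreath products as permutation groups *)

Section WreathProduct.

Variables bT cT : finGroupType.
Implicit Types (f g : cT -> bT) (c : cT) (b : bT).

Lemma base_inj f : injective (fun x : bT * cT => (x.1 * f x.2, x.2)).
Proof. by move=> [x i] [y j] /= [+ eij]; rewrite eij => /mulIg ->. Qed.

(** Functions act by right translation inside each fibre and [top] permutes the fibres, so the
    wreath product lives in one symmetric group. Right multiplication matches the left-to-right
    composition of permutations. *)
Definition base f : {perm bT * cT} := perm (@base_inj f).

Lemma baseE f x i : base f (x, i) = (x * f i, i).
Proof. by rewrite permE. Qed.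

Lemma top_inj c : injective (fun x : bT * cT => (x.1, x.2 * c)).
Proof. by move=> [x i] [y j] /= [-> /mulIg ->]. Qed.

Definition top c : {perm bT * cT} := perm (@top_inj c).

Lemma topE c x i : top c (x, i) = (x, i * c).
Proof. by rewrite permE. Qed.

Lemma eq_base f g : f =1 g -> base f = base g.
Proof. by move=> efg; apply/permP=> -[x i]; rewrite !baseE efg. Qed.

Lemma baseM f g : base f * base g = base (fun i => f i * g i).
Proof. by apply/permP=> -[x i]; rewrite permM !baseE mulgA. Qed.

Lemma base1 : base (fun=> 1) = 1.
Proof. by apply/permP=> -[x i]; rewrite baseE perm1 mulg1. Qed.

Lemma baseV f : (base f)^-1 = base (fun i => (f i)^-1).
Proof.
apply: (mulgI (base f)); rewrite mulgV baseM -base1.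
by apply: eq_base => i; rewrite mulgV.
Qed.

Lemma topM : {morph top : c d / c * d}.
Proof. by move=> c d; apply/permP=> -[x i]; rewrite permM !topE mulgA. Qed.

Canonical top_morphism := @Morphism _ _ setT _ (in2W topM).

Lemma injm_top : 'injm top.
Proof.
apply/subsetP=> c /morphpreP[_ /set1P/permP/(_ (1, 1))].
by rewrite topE perm1 mul1g => -[->]; apply: set11.
Qed.

Definition diag b := base (fun=> b).

Lemma diagM : {morph diag : b d / b * d}.
Proof. by move=> b d; rewrite /diag baseM. Qed.

Canonical diag_morphism := @Morphism _ _ setT _ (in2W diagM).

Lemma baseJ_top f c : base f ^ top c = base (fun i => f (i * c^-1)).
Proof.
apply: (mulgI (top c)); rewrite -conjgC; apply/permP=> -[x i].
by rewrite !permM topE !baseE topE mulgK.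
Qed.

Lemma diag_top b c : commute (diag b) (top c).
Proof. by rewrite /commute conjgC {2}/diag baseJ_top. Qed.

Variable M : {group bT}.

Definition base_set : {set {perm bT * cT}} :=
  [set base f | f : {ffun cT -> bT} in ffun_on (mem M)].

Lemma mem_base f : (forall i, f i \in M) -> base f \in base_set.
Proof.
move=> Mf; apply/imsetP; exists [ffun i => f i].
  by apply/ffun_onP=> i; rewrite ffunE.
by apply: eq_base => i; rewrite ffunE.
Qed.

Lemma base_setP s :
  reflect (exists2 f, s = base f & forall i, f i \in M) (s \in base_set).
Proof.
apply: (iffP idP) => [/imsetP[f /ffun_onP Mf ->] | [f -> /mem_base //]].
by exists f.
Qed.

Lemma base_group_set : group_set base_set.
Proof.
apply/group_setP; split; first by rewrite -base1 mem_base.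
move=> _ _ /base_setP[f -> Mf] /base_setP[g -> Mg].
by rewrite baseM mem_base // => i; rewrite groupM.
Qed.

Canonical base_group := Group base_group_set.

Lemma card_base_set : #|base_set| = (#|M| ^ #|cT|)%N.
Proof.
rewrite card_in_imset ?card_ffun_on // => f g _ _ /permP efg.
by apply/ffunP=> i; have:= efg (1, i); rewrite !baseE !mul1g => -[].
Qed.

Lemma base_norm_top : top @* [set: cT] \subset 'N(base_set).
Proof.
apply/subsetP=> _ /morphimP[c _ _ ->]; rewrite inE.
apply/subsetP=> _ /imsetP[_ /base_setP[f -> Mf] ->].
by rewrite baseJ_top mem_base.
Qed.

Lemma base_norm_diag (C : {set bT}) :
  C \subset 'N(M) -> diag @* C \subset 'N(base_set).
Proof.
move/subsetP=> nMC; apply/subsetP=> _ /morphimP[c _ /nMC nMc ->]; rewrite inE.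
apply/subsetP=> _ /imsetP[_ /base_setP[f -> Mf] ->].
rewrite /conjg /= baseV !baseM mem_base // => i.
by rewrite -/(conjg _ _) memJ_norm.
Qed.

Definition coord i b := base (fun j => if j == i then b else 1).

Lemma coordJ_top i b c : coord i b ^ top c = coord (i * c) b.
Proof.
rewrite baseJ_top; apply: eq_base => j.
by rewrite -[in LHS](inj_eq (mulIg c)) mulgKV.
Qed.

Lemma coordR i x y : [~ coord i x, coord i y] = coord i [~ x, y].
Proof.
rewrite /commg /conjg !baseV !baseM; apply: eq_base => j.
by case: eqP; rewrite ?invg1 ?mulg1.
Qed.

Lemma coordM i : {morph coord i : x y / x * y}.
Proof.
by move=> x y; rewrite baseM; apply: eq_base => j; case: eqP; rewrite ?mulg1.
Qed.

Canonical coord_morphism i := @Morphism _ _ setT _ (in2W (coordM i)).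

(* The first coordinate of a base group element, as a relation rather than a
   morphism, so that no domain has to be specified. *)
Definition at1 :=
  [set x : {perm bT * cT} * bT | [forall y, x.1 (y, 1) == (y * x.2, 1)]].

Lemma at1P (x : {perm bT * cT} * bT) :
  reflect (forall y, x.1 (y, 1) = (y * x.2, 1)) (x \in at1).
Proof. by rewrite inE; apply: eqfunP. Qed.

Lemma at1_group_set : group_set at1.
Proof.
apply/group_setP; split; first by apply/at1P=> y; rewrite perm1 mulg1.
move=> x z /at1P ex /at1P ez; apply/at1P=> y.
by rewrite permM ex ez /= mulgA.
Qed.

Canonical at1_group := Group at1_group_set.

Lemma base_at1 f : (base f, f 1) \in at1.
Proof. by apply/at1P=> y; rewrite baseE. Qed.

Lemma coord_commute i j x y : i != j -> commute (coord i x) (coord j y).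
Proof.
move=> neij; rewrite /commute !baseM; apply: eq_base => k.
case: (k =P i) => [->|_]; last by rewrite mul1g mulg1.
by rewrite (negPf neij) mul1g mulg1.
Qed.

Lemma base_in_coord (W : {group {perm bT * cT}}) f :
  (forall i, coord i (f i) \in W) -> base f \in W.
Proof.
move=> Wf; pose fs (s : seq cT) j := if j \in s then f j else 1.
(* Induction on the support: [fs s] agrees with [f] on [s] and is 1 elsewhere. As [s] is
   duplicate-free, each step multiplies by a single new coordinate. *)
suff Ws (s : seq cT) : uniq s -> base (fs s) \in W.
  have := Ws _ (enum_uniq cT); rewrite (@eq_base _ f) // => j.
  by rewrite /fs mem_enum.
elim: s => [_|i s IHs /= /andP[nsi /IHs Ws]]; first by rewrite base1.
rewrite (_ : base _ = coord i (f i) * base (fs s)); first by rewrite groupM.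
rewrite baseM; apply: eq_base => j; rewrite /fs inE.
by case: eqP => [->|_] /=; rewrite ?(negPf nsi) ?mulg1 ?mul1g.
Qed.

(* Modulo [W], the coordinate embeddings of [M] all agree, while those with
   distinct indices commute elementwise; so all commutators land in [W]. *)
Lemma diag_der1 : 1 < #|cT| ->
  diag @* M^`(1) \subset [~: base_set, top @* [set: cT]].
Proof.
move=> cT_gt1; set W := [~: _, _].
have [c ntc] : exists c : cT, c != 1.
  have /trivgPn[c _ ntc]: [set: cT] :!=: 1 by rewrite -cardG_gt1 cardsT.
  by exists c.
have Mcoord i x : x \in M -> coord i x \in base_set.
  by move=> Mx; apply: mem_base => j; case: eqP.
have nWV : base_set \subset 'N(W) by apply: commg_norml.
have nW i x : x \in M -> coord i x \in 'N(W).
  by move=> Mx; rewrite (subsetP nWV) ?Mcoord.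
have coordW i x : x \in M -> coset W (coord i x) = coset W (coord 1 x).
  move=> Mx; have Ws : [~ coord 1 x, top i] \in W.
    by rewrite mem_commg ?Mcoord ?mem_morphim ?inE.
  rewrite -[i in LHS]mul1g -coordJ_top conjg_mulR morphM ?nW //.
    by rewrite /= (coset_id Ws) mulg1.
  exact: (subsetP (normG _)).
apply/subsetP=> _ /morphimP[z _ M'z ->]; apply: base_in_coord => i.
(* This preimage is a group, so only the generating commutators [[~ x, y]] need checking. *)
have: z \in coord i @*^-1 W.
  apply: subsetP z M'z; rewrite gen_subG.
  apply/subsetP=> _ /imset2P[x y Mx My ->]; rewrite mem_morphpre ?inE //=.
  apply: coset_idr; first by rewrite nW ?groupR.
  rewrite -coordR.
  have [j neij] : exists j : cT, i != j.
    by exists (i * c); rewrite -{1}[i]mulg1 (inj_eq (mulgI i)) eq_sym.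
  rewrite morphR ?nW //= [coset W (coord i y)]coordW // -(coordW j) //.
  rewrite -morphR ?nW //=; have /commgP/eqP-> := coord_commute x y neij.
  by rewrite morph1.
by case/morphpreP.
Qed.

End WreathProduct.

(** * The extension that splits in H but not in G *)

Section Construction.

Variables (wT bT : finGroupType) (W P : {group wT}) (M B C : {group bT}).
Variable p : nat.
(** [d] stands for the diagonal embedding and [Gam] for the graph of the projection to one
    coordinate: [Gam_ker] makes it single-valued, [GamW] makes it defined on [W] with values in [M],
    and [Gamd] says that it inverts [d] on [C]. *)
Variables (d : {morphism [set: bT] >-> wT}) (Gam : {group wT * bT}).

Hypotheses (nsMB : M <| B) (defB : M * C = B).
Hypotheses (cardP : #|P| = p) (pr_P : prime #|P|) (coBP : coprime #|B| #|P|).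
Hypotheses (coWP : coprime #|W| #|P|).
Hypotheses (nWP : P \subset 'N(W)) (WPW : [~: W, P] = W).
Hypotheses (nWd : d @* C \subset 'N(W)) (cdP : d @* C \subset 'C(P)).
Hypotheses (sdW : d @* (M :&: C) \subset W).
Hypotheses (Gam_ker : forall m, (1, m) \in Gam -> m = 1).
Hypotheses (GamW : forall w, w \in W -> exists2 m, m \in M & (w, m) \in Gam).
Hypotheses (Gamd : forall c, c \in C -> (d c, c) \in Gam).

Let graph (b : bT) : wT * bT := (d b, b).

Let graphM : {in [set: bT] &, {morph graph : x y / x * y}}.
Proof. by move=> x y _ _; rewrite /graph morphM ?inE. Qed.

Let graph_morphism := Morphism graphM.

Let D := (graph_morphism @* C)%G.
Let K := [group of setX (1%G : {group wT}) M].
Let U := [group of setX W M].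
Let H := (U <*> D)%G.
Let P1 := [group of setX P (1%G : {group bT})].
Let G := (H <*> P1)%G.

Let sCB : C \subset B.
Proof. by rewrite -defB mulG_subr. Qed.

Let sMB : M \subset B.
Proof. exact: normal_sub. Qed.

Let nMB : B \subset 'N(M).
Proof. exact: normal_norm. Qed.

Let memDP x : reflect (exists2 c, c \in C & x = (d c, c)) (x \in D).
Proof.
apply: (iffP morphimP) => [[c _ Cc ->]|[c Cc ->]]; first by exists c.
by exists c; rewrite ?inE.
Qed.

Let sDX : D \subset setX (d @* C) C.
Proof.
by apply/subsetP=> _ /memDP[c Cc ->]; rewrite in_setX /= mem_morphim ?inE.
Qed.

Let nUD : D \subset 'N(U).
Proof.
exact: subset_trans sDX (setX_norms nWd (subset_trans sCB nMB)).
Qed.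

Let nUP1 : P1 \subset 'N(U).
Proof. by apply: setX_norms; rewrite ?sub1G. Qed.

Let cDP1 : P1 \subset 'C(D).
Proof.
apply/centsP=> -[s b]; rewrite in_setX /= inE => /andP[Ps /eqP->].
move=> _ /memDP[c Cc ->]; have /centsP/(_ (d c)) := cdP.
rewrite mem_morphim ?inE // => /(_ isT s Ps) dcs.
by congr (_, _); rewrite ?mulg1 ?mul1g.
Qed.

Let nHP1 : P1 \subset 'N(H).
Proof. by rewrite normsY // cents_norm. Qed.

Let defH : U * D = H.
Proof. by rewrite /= norm_joinEr. Qed.

Let defG : H * P1 = G.
Proof. exact: esym (norm_joinEr nHP1). Qed.

Let coHP1 : coprime #|H| #|P1|.
Proof.
have -> : #|P1| = #|P| by rewrite cardsX cards1 muln1.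
have cU : coprime #|U| #|P|.
  by rewrite cardsX coprimeMl coWP (coprime_dvdl (cardSg sMB)).
have cD : coprime #|D| #|P|.
  apply: coprime_dvdl (dvdn_morphim _ _) _.
  by rewrite (coprime_dvdl (cardSg sCB)).
(* [U] and [D] may intersect, so the order of their product is only known to divide the product of
   their orders. *)
rewrite -defH /=; apply: coprime_dvdl (_ : coprime (#|U| * #|D|)%N #|P|).
  by rewrite mul_cardG dvdn_mulr.
by rewrite coprimeMl cU.
Qed.

Let tiHP1 : H :&: P1 = 1.
Proof. exact: coprime_TIg. Qed.

Let nsHG : H <| G.
Proof. by rewrite /normal joing_subl join_subG normG nHP1. Qed.

Let sKH : K \subset H.
Proof.
by apply: subset_trans (joing_subl _ _); apply: setXS; rewrite ?sub1G.
Qed.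

Let sGX : G \subset setX [set: wT] B.
Proof.
rewrite !join_subG -andbA; apply/and3P; split.
- by apply: setXS; rewrite ?subsetT.
- by apply: subset_trans sDX (setXS _ _); rewrite ?subsetT.
by apply: setXS; rewrite ?subsetT ?sub1G.
Qed.

Let nsKG : K <| G.
Proof.
rewrite /normal (subset_trans sKH (normal_sub nsHG)).
by apply: subset_trans sGX (setX_norms _ nMB); rewrite norms1.
Qed.

Let GH_isog : G / H \isog Zp p.
Proof.
rewrite -cardP.
have isoP: P1 \isog G / H by apply: sdprod_isog; rewrite sdprodE.
have cP1 : #|P1| = #|P| by rewrite cardsX cards1 muln1.
have /cyclicP[x defP1] : cyclic P1 by rewrite prime_cyclic ?cP1.
rewrite isog_sym in isoP; apply: isog_trans isoP _.
by rewrite -cP1 /= defP1 isog_sym Zp_isog.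
Qed.

(** The complement is the part of [H] on the graph [Gam]. To reach all of [H], the [M]-component [m]
    over [w] is replaced by the value [n] of the projection at [w], and [(1, m * n^-1)] is absorbed
    by [K]. *)
Let splitsH : [splits H, over K].
Proof.
apply/splitsP; exists (H :&: Gam)%G; apply/complP; split.
  apply/trivgP/subsetP=> -[w m]; rewrite !inE /=.
  by case/andP=> /andP[/eqP-> _] /andP[_ /Gam_ker ->].
apply/eqP; rewrite eqEsubset mul_subG ?subsetIl //.
apply/subsetP=> x Hx; have:= Hx; rewrite -{1}defH.
case/mulsgP=> -[w m] _ + /memDP[c Cc ->] ->; rewrite in_setX /= => /andP[Ww Mm].
have [n Mn Gwn] := GamW Ww.
rewrite (_ : _ * _ = (1, m * n^-1) * ((w, n) * (d c, c))); last first.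
  by congr (_, _); rewrite /= ?mul1g // mulgA mulgKV.
apply: mem_mulg; first by rewrite in_setX /= group1 groupM ?groupV.
rewrite in_setI -{1}defH mem_mulg ?in_setX ?Ww //=; last first.
  by apply/memDP; exists c.
by rewrite groupM ?Gamd.
Qed.

Let splits_of_sub_complement (X : {group wT * bT}) :
  X \in [complements to K in G] -> P1 \subset X -> [splits B, over M].
Proof.
move=> /complP[tiKX defKX] sPX.
have sXG : X \subset G by rewrite -defKX mulG_subr.
have sWX w : w \in W -> (w, 1) \in X.
  rewrite -WPW => Ww.
  suff: W \subset pairg1 bT @*^-1 X
    by rewrite -WPW => /subsetP/(_ w Ww)/morphpreP[].
  rewrite -{1}WPW gen_subG; apply/subsetP=> _ /imset2P[v s Wv Ps ->].
  rewrite mem_morphpre ?inE //=.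
  (* Since [K * X] is [G], some [(v, n^-1)] lies in [X]; its commutator with [(s, 1)] is [([~ v, s],
     1)]. *)
  have : (v, 1) \in K * X.
    rewrite defKX -defG -defH; apply: (subsetP (mulG_subl _ _)).
    by apply: (subsetP (mulG_subl _ _)); rewrite in_setX Wv group1.
  case/mulsgP=> -[k n] x; rewrite in_setX inE /= => /andP[/eqP-> Mn] Xx.
  move=> /(canLR (mulKg _)) ex.
  have {ex} defx : x = (v, n^-1).
    by rewrite -ex; congr (_, _); rewrite /= ?invg1 ?mul1g ?mulg1.
  have Xs : (s, 1) \in X by rewrite (subsetP sPX) // in_setX Ps group1.
  have := groupR Xx Xs; rewrite defx.
  by congr (_ \in X); congr (_, _); exact: commg1.
apply/splitsP; exists (@snd wT bT @* X)%G; apply/complP; split.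
  (* If [(q, m)] is in [X] with [m] in [M], then its [C]-component [c] is in [M], so [d c] is in [W]
     and [q] is in [W * P]. Hence [(q, 1)] is in [X], and [(1, m)] is in both [K] and [X]. *)
  apply/trivgP/subsetP=> m /setIP[Mm /morphimP[[q b] _ Xx /= defm]].
  rewrite -{b}defm in Xx.
  have := subsetP sXG _ Xx; rewrite -defG -defH.
  case/mulsgP=> _ [s t] /mulsgP[[w n] _ + /memDP[c Cc ->] ->].
  rewrite !in_setX !inE /= => /andP[Ww Mn] /andP[Ps /eqP->] [defq defm].
  have Mc : c \in M.
    by rewrite -(groupMl c Mn); move: Mm; rewrite defm mulg1.
  have Wd : d c \in W by rewrite (subsetP sdW) // mem_morphim ?inE // Mc.
  have Xq : (q, 1) \in X.
    have -> : (q, 1) = (w * d c, 1) * (s, 1) :> wT * bT.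
      by rewrite defq; congr (_, _); rewrite /= mulg1.
    apply: groupM; first by apply: sWX; rewrite groupM.
    by rewrite (subsetP sPX) // in_setX Ps group1.
  have : (1, m) \in K :&: X.
    rewrite in_setI in_setX /= group1 Mm /=.
    have -> : (1, m) = (q, 1)^-1 * (q, m) :> wT * bT.
      by congr (_, _); rewrite /= ?mulVg ?invg1 ?mul1g.
    by rewrite groupM ?groupV.
  by rewrite tiKX => /set1P[->].
apply/eqP; rewrite eqEsubset mul_subG //=; last first.
  apply/subsetP=> _ /morphimP[x _ /(subsetP sXG)/(subsetP sGX) + ->].
  by rewrite !inE => /andP[].
rewrite -defB; apply/subsetP=> _ /mulsgP[m c Mm Cc ->].
have : (d c, c) \in K * X.
  rewrite defKX -defG -defH; apply: (subsetP (mulG_subl _ _)).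
  by apply: (subsetP (mulG_subr _ _)); apply/memDP; exists c.
case/mulsgP=> -[k n] x; rewrite in_setX /= => /andP[_ Mn] Xx [_ ->].
by rewrite mulgA mem_mulg ?groupM //; apply/morphimP; exists x; rewrite ?inE.
Qed.

(** The index of [X] in [G] is [#|M|], prime to [p], so a Sylow subgroup of [X] is Sylow in [G] and
    some conjugate of it contains [P1]. Conjugates of [X] still complement the normal subgroup
    [K]. *)
Let splitsB_of_splitsG : [splits G, over K] -> [splits B, over M].
Proof.
case/splitsP=> X cplX; have /complP[tiKX defKX] := cplX.
have cP1 : #|P1| = #|P| by rewrite cardsX cards1 muln1.
have sXG : X \subset G by rewrite -defKX mulG_subr.
have [S sylS] := Sylow_exists #|P| X.
have p'K : ~~ (#|P| %| #|G : X|).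
  have -> : #|G : X| = #|M|.
    rewrite -divgS // -defKX TI_cardMg // mulnK // cardsX cards1 mul1n //.
  rewrite -prime_coprime // coprime_sym; exact: coprime_dvdl (cardSg sMB) _.
have sylSG : #|P|.-Sylow(G) S.
  rewrite pHallE (subset_trans (pHall_sub sylS)) //= (card_Hall sylS).
  rewrite -(Lagrange sXG) partnM // [X in (_ * X)%N]part_p'nat ?muln1 //.
  by rewrite p'natE.
have pP1 : #|P|.-group P1 by rewrite /pgroup cP1 pnat_id.
have [x Gx sPS] := Sylow_subJ sylSG (joing_subr _ _) pP1.
apply: (@splits_of_sub_complement (X :^ x)%G); last first.
  by apply: subset_trans sPS _; rewrite conjSg (pHall_sub sylS).
have nKx : K :^ x = K by rewrite (normsP (normal_norm nsKG)).
apply/complP; split; first by rewrite /= -nKx -conjIg tiKX conjs1g.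
by rewrite /= -nKx -conjsMg defKX conjGid.
Qed.

Lemma nonsplit_extension : ~~ [splits B, over M] ->
  exists K G H : {group wT * bT},
  [/\ K \isog M, K <| G, K \subset H & H <| G] /\
  [/\ G / H \isog Zp p, [splits H, over K] & ~~ [splits G, over K]].
Proof.
move=> nsB; exists K, G, H; split; split=> //.
  by rewrite isog_sym isog_set1X.
by apply: contra nsB; apply: splitsB_of_splitsG.
Qed.

End Construction.

(** * Complements modulo the derived subgroup, and the equivalence *)

(** [C] is the full preimage of the given complement, which trades a trivial intersection for the
    derived subgroup. *)
Lemma abelianization_complement (gT : finGroupType) (M B : {group gT}) :
  M <| B -> [splits B / M^`(1), over M / M^`(1)] ->
  exists2 C : {group gT}, M * C = B & M :&: C = M^`(1).
Proof.
move=> nsMB /splitsP[Kb /complP[tiMK defB]].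
have nsM'B : M^`(1) <| B by apply: gFnormal_trans.
have sKB : Kb \subset B / M^`(1) by rewrite -defB mulG_subr.
have [C defK sM'C sCB] := inv_quotientS nsM'B sKB.
have nM'B := normal_norm nsM'B; have sMB := normal_sub nsMB.
rewrite {Kb sKB}defK in tiMK defB.
exists C; last first.
  apply/eqP; rewrite eqEsubset subsetI der_sub sM'C !andbT.
  rewrite -quotient_sub1; last by rewrite subIset // (subset_trans sMB).
  by rewrite quotientGI ?der_sub // tiMK.
have nMC : C \subset 'N(M) := subset_trans sCB (normal_norm nsMB).
apply/eqP; rewrite eqEsubset mul_subG //= -norm_joinEr //.
rewrite -(quotientSGK nM'B) ?(subset_trans (der_sub 1 M)) ?joing_subl //.
by rewrite /= norm_joinEr // quotientMl ?(subset_trans sMB) // defB.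
Qed.

Lemma nonsplit_over_split_normal (bT : finGroupType) (M B : {group bT}) p :
  M <| B -> [splits B / M^`(1), over M / M^`(1)] -> ~~ [splits B, over M] ->
  prime p -> ~~ (p %| #|B|) ->
  exists (rT : finGroupType) (K G H : {group rT}),
    [/\ K \isog M, K <| G, K \subset H & H <| G] /\
    [/\ G / H \isog Zp p, [splits H, over K] & ~~ [splits G, over K]].
Proof.
move=> nsMB spB nspB pr_p p'B.
have [C defB tiMC] := abelianization_complement nsMB spB.
pose P := [group of top bT (cT:='Z_p) @* [set: 'Z_p]].
pose V := [group of base_set 'Z_p M].
(* The type ['Z_p] has [p] elements only because [p] exceeds 1. *)
have cardZ : #|'Z_p| = p by rewrite card_ord Zp_cast ?prime_gt1.
have cardP : #|P| = p by rewrite card_injm ?injm_top ?subsetT // cardsT.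
have coBp : coprime #|B| p by rewrite coprime_sym prime_coprime.
have sMB := normal_sub nsMB.
have sCB : C \subset B by rewrite -defB mulG_subr.
have nVP : P \subset 'N(V) by apply: base_norm_top.
have coVP : coprime #|V| #|P|.
  by rewrite cardP card_base_set coprimeXl // (coprime_dvdl (cardSg sMB)).
have nVd : diag 'Z_p @* C \subset 'N(V).
  by apply: base_norm_diag; apply: subset_trans (normal_norm nsMB).
have cdP : diag 'Z_p @* C \subset 'C(P).
  apply/centsP=> _ /morphimP[c _ _ ->] _ /morphimP[t _ _ ->].
  exact: diag_top.
have sWV : [~: V, P] \subset V by rewrite commg_subl.
exists ({perm bT * 'Z_p} * bT)%type.
(* [Gam] is [at1], evaluation at the identity index; [diag_der1] and [tiMC] supply the hypothesis
   [sdW]. *)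
apply: (@nonsplit_extension _ _ [~: V, P] P M B C p (diag_morphism _ _)
  (at1_group _ _)) => //.
- by rewrite cardP.
- by rewrite cardP.
- exact: coprime_dvdl (cardSg sWV) coVP.
- exact: commg_normr.
- exact: coprime_commRR.
- by rewrite normsR // cents_norm.
- by rewrite tiMC diag_der1 // cardZ prime_gt1.
- by move=> m /at1P/(_ 1); rewrite perm1 mul1g => -[].
- move=> w /(subsetP sWV)/base_setP[f -> Mf]; exists (f 1) => //.
  exact: base_at1.
by move=> c _; apply: base_at1.
Qed.

Theorem theorem2p1 (gT : finGroupType) (N : {group gT}) :
  (gaschutz_holds N <-> splits_if_abelianization_splits N) /\
  (forall (bT : finGroupType) (M B : {group bT}),
     M \isog N -> M <| B ->
     [splits B / M^`(1), over M / M^`(1)] -> ~~ [splits B, over M] ->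
     forall p : nat, prime p -> ~~ (p %| #|B|) ->
       exists (rT : finGroupType) (K G H : {group rT}),
         [/\ K \isog N, K <| G, K \subset H & H <| G] /\
         [/\ G / H \isog Zp p, [splits H, over K] & ~~ [splits G, over K]]).
Proof.
split; last first.
  move=> bT M B isoMN nsMB spB nspB p pr_p p'B.
  have [rT [K [G [H [[isoKM ? ? ?] ?]]]]] :=
    nonsplit_over_split_normal nsMB spB nspB pr_p p'B.
  exists rT, K, G, H; split=> //; split=> //; exact: isog_trans isoKM isoMN.
split=> [gasN rT M B isoMN nsMB spB | abN rT M G H isoMN nsMG sMH sHG co spH].
  (* A prime larger than [#|B|] cannot divide it, so a counterexample to (ii) yields one to (i). *)
  apply: contraT=> nspB; have [p ltBp pr_p] := prime_above #|B|.
  have p'B : ~~ (p %| #|B|) by rewrite gtnNdvd.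
  have [sT [K [G [H [[isoKM nsKG sKH nsHG] [isoP spH /negP[]]]]]]] :=
    nonsplit_over_split_normal nsMB spB nspB pr_p p'B.
  apply: (gasN _ _ _ H) => //; first exact: isog_trans isoKM isoMN.
    exact: normal_sub.
  have [/andP[_ nHG] p_gt0] := (nsHG, prime_gt0 pr_p).
  rewrite -card_quotient // (card_isog isoP) card_Zp // (card_isog isoKM).
  rewrite coprime_sym prime_coprime //; apply: contra p'B => /dvdn_trans-> //.
  by rewrite cardSg ?normal_sub.
(* By (ii) it is enough to split [G / M'] over the abelian group [M / M'], where the classical
   theorem applies. *)
apply: abN => //; set M' := M^`(1).
have nsM'G : M' <| G by apply: gFnormal_trans.
have nM'G := normal_norm nsM'G.
have nM'H := subset_trans sHG nM'G; have nM'M := subset_trans sMH nM'H.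
rewrite (@Gaschutz_split _ _ _ (H / M')%G) ?quotient_normal ?quotientS //.
- have /splitsP[K /complP[tiMK defH]] := spH.
  apply/splitsP; exists (K / M')%G; apply/complP; split.
    by rewrite -quotientGI ?der_sub // tiMK quotient1.
  by rewrite -quotientMl // defH.
- exact: der_abelian.
have sM'H : M' \subset H := subset_trans (der_sub 1 M) sMH.
(* As [M'] lies in [H], the index of [H] is unchanged in the quotient. *)
rewrite index_quotient_eq ?subIset ?sM'H ?orbT //.
exact: coprime_dvdl (dvdn_quotient _ _) co.
Qed.
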